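(* Let $\mathcal{A}$ be a unital alternative algebra over a field $F$ containing a generalized quaternion algebra $\mathbb{H}$ with the same identity element, and let $\mathcal{A}=\mathcal{A}_a\oplus\mathcal{A}_c$ be its decomposition as an $\mathbb{H}$-bimodule into associative part $\mathcal{A}_a$ and Cayley part $\mathcal{A}_c$. Then $\mathcal{A}=\mathcal{A}_a\oplus\mathcal{A}_c$ is a $\mathbb{Z}_2$-graded algebra, where $\mathcal{A}_a$ is the even part and $\mathcal{A}_c$ is the odd part of the $\mathbb{Z}_2$-grading.
   Context: $F$ has arbitrary characteristic. An algebra is alternative if $x^2y=x(xy)$ and $(xy)y=xy^2$. The associator is $(x,y,z)=(xy)z-x(yz)$. A generalized quaternion algebra $\mathbb{H}$ over $F$ is a 4-dimensional composition algebra (a 4-dimensional central simple associative algebra, possibly split), with canonical symplectic involution $a\mapsto a^*$ such that $a+a^*\in F$ and $aa^*\in F$. View $\mathcal{A}$ as an $\mathbb{H}$-bimodule by multiplication. It is known that $\mathcal{A}=\mathcal{A}_a\oplus\mathcal{A}_c$ as $\mathbb{H}$-bimodules, where $\mathcal{A}_a$ is an associative $\mathbb{H}$-bimodule (all associators with one argument in $\mathcal{A}_a$ and two in $\mathbb{H}$ vanish) and $\mathcal{A}_c$ is a Cayley bimodule ($am=ma^*$ for all $a\in\mathbb{H}$, $m\in\mathcal{A}_c$); moreover $\mathcal{A}_c=(\mathcal{A},\mathbb{H},\mathbb{H})$ is the span of the associators $(x,a,b)$, $x\in\mathcal{A}$, $a,b\in\mathbb{H}$. *)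

(* Defs.v *)
From HB Require Import structures.
From mathcomp Require Import all_boot all_algebra all_field.
From mathcomp Require Import ring.

Set Implicit Arguments.
Unset Strict Implicit.
Unset Printing Implicit Defensive.

Import GRing.Theory.
Local Open Scope ring_scope.

(* The library has no structure for non-associative algebras: such an algebra
   is a (possibly infinite-dimensional) F-module A with a bilinear product. *)
Section NonAssociative.

Variables (F : fieldType) (A : lmodType F) (mul : {bilinear A -> A -> A}).

Definition associator (x y z : A) : A := mul (mul x y) z - mul x (mul y z).

Definition alternative : Prop :=
  (forall x y, mul (mul x x) y = mul x (mul x y)) /\
  (forall x y, mul (mul x y) y = mul x (mul y y)).

Definition unit_element (e : A) : Prop :=
  forall x, mul e x = x /\ mul x e = x.

Definition direct_sum (U V : {pred A}) : Prop :=
  (forall x, exists u v, [/\ u \in U, v \in V & x = u + v]) /\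
  (forall x, x \in U -> x \in V -> x = 0).

Definition Z2_grading (G : 'Z_2 -> {pred A}) : Prop :=
  [/\ forall i, submod_closed (G i),
      direct_sum (G 0) (G 1)
    & forall i j x y, x \in G i -> y \in G j -> mul x y \in G (i + j)].

End NonAssociative.

(* Quadratic forms are defined so as to make sense in characteristic 2, where
   nondegeneracy has to be required of the polar form. *)
Section Composition.

Variables (F : fieldType) (H : falgType F) (n : H -> F).

Definition polar (a b : H) : F := n (a + b) - n a - n b.

Definition quadratic_form : Prop :=
  (forall c a, n (c *: a) = c ^+ 2 * n a) /\ bilinear_for *%R *%R polar.

Definition composition_norm : Prop :=
  [/\ quadratic_form,
      forall a, (forall b, polar a b = 0) -> a = 0
    & forall a b, n (a * b) = n a * n b].

(* A 4-dimensional composition algebra is associative, hence H : falgType F.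
   Its norm n is unique, so n is a parameter rather than extra structure. *)
Definition generalized_quaternion : Prop :=
  \dim {:H} = 4 /\ composition_norm.

(* The canonical involution of a composition algebra: a^* = t(a) 1 - a, where
   t(a) = n(a, 1) is the trace; see qconjD, qconjM, qconjMr, qconjK below. *)
Definition qconj (a : H) : H := (polar a 1)%:A - a.

End Composition.

(* A contains H as a unital subalgebra, through the embedding iota. *)
Section Bimodule.

Variables (F : fieldType) (A : lmodType F) (mul : {bilinear A -> A -> A}).
Variables (H : falgType F) (iota : {linear H -> A}).

Definition unital_embedding (e : A) : Prop :=
  [/\ injective iota, iota 1 = e
    & forall a b, iota (a * b) = mul (iota a) (iota b)].

Definition subbimodule (M : {pred A}) : Prop :=
  submod_closed M /\
  forall a x, x \in M -> mul (iota a) x \in M /\ mul x (iota a) \in M.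

Definition associative_bimodule (M : {pred A}) : Prop :=
  subbimodule M /\
  forall a b x, x \in M ->
    [/\ associator mul x (iota a) (iota b) = 0,
        associator mul (iota a) x (iota b) = 0
      & associator mul (iota a) (iota b) x = 0].

Definition Cayley_bimodule (n : H -> F) (M : {pred A}) : Prop :=
  subbimodule M /\
  forall a x, x \in M -> mul (iota a) x = mul x (iota (qconj n a)).

End Bimodule.

Section QconjTheory.

Variables (F : fieldType) (H : falgType F) (n : H -> F).
Hypothesis Hn : composition_norm n.

Local Notation "<< a , b >>" := (polar n a b).

Let lin (u v x y : F) : u = v -> x - y = u - v -> x = y.
Proof. by move=> ->; rewrite subrr => /eqP; rewrite subr_eq0 => /eqP. Qed.

Let polarDl a b c : <<a + b, c>> = <<a, c>> + <<b, c>>.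
Proof. by case: Hn => -[_ [L _]] _ _; have := L c 1 a b; rewrite scale1r /= mul1r. Qed.

Let polarC a b : <<a, b>> = <<b, a>>.
Proof. by rewrite /polar [a + b]addrC addrAC. Qed.

Let polarDr a b c : <<c, a + b>> = <<c, a>> + <<c, b>>.
Proof. by rewrite polarC polarDl !(polarC c). Qed.

Let polarZl k a c : <<k *: a, c>> = k * <<a, c>>.
Proof.
case: Hn => -[_ [L _]] _ _; have := L c k a 0; rewrite addr0 /= => ->.
have: <<0 + 0, c>> = <<0, c>> by rewrite addr0.
by rewrite polarDl => /(canRL (addrK _)) ->; rewrite subrr !addr0.
Qed.

Let polarNl a c : <<- a, c>> = - <<a, c>>.
Proof. by rewrite -scaleN1r polarZl mulN1r. Qed.

Let nD a b : n (a + b) = n a + n b + <<a, b>>.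
Proof. by rewrite /polar; ring. Qed.

Let polarMl x a b : <<x * a, x * b>> = n x * <<a, b>>.
Proof. by case: Hn => _ _ nM; rewrite /polar -mulrDr !nM; ring. Qed.

Let polarM2 x y a b : <<x * a, y * b>> + <<y * a, x * b>> = <<x, y>> * <<a, b>>.
Proof.
have := polarMl (x + y) a b.
rewrite !mulrDl polarDl !polarDr !polarMl nD => E.
by apply: (lin E); rewrite /polar nD; ring.
Qed.

Let polar1M a b c : <<a * b, c>> + <<b, a * c>> = <<a, 1>> * <<b, c>>.
Proof. by have := polarM2 a 1 b c; rewrite !mul1r. Qed.

Let polarM1 a b : <<a * b, 1>> = <<a, 1>> * <<b, 1>> - <<a, b>>.
Proof. by have := polar1M a b 1; rewrite mulr1 (polarC b a) => <-; ring. Qed.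

Let polar_inj a b : (forall c, <<a, c>> = <<b, c>>) -> a = b.
Proof.
move=> E; apply/eqP; rewrite -subr_eq0; apply/eqP.
by case: Hn => _ nd _; apply: nd => c; rewrite polarDl polarNl E subrr.
Qed.

Lemma qconjD a : a + qconj n a = <<a, 1>>%:A.
Proof. by rewrite addrC subrK. Qed.

Lemma qconjM a : a * qconj n a = (n a)%:A.
Proof.
apply: polar_inj => c; rewrite /qconj mulrBr -scalerAr mulr1.
rewrite polarDl polarNl !polarZl.
have E := polar1M a a c; have := polarMl a 1 c; rewrite mulr1 => E1.
by rewrite -E E1; ring.
Qed.

Lemma qconjMr a b : qconj n (a * b) = qconj n b * qconj n a.
Proof.
apply: polar_inj => c.
rewrite /qconj mulrBl !mulrBr -!scalerAl -!scalerAr !mul1r mulr1.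
rewrite !(polarDl, polarNl, polarZl) polarM1.
have E1 := polar1M a b c; have E2 := polar1M b a c.
have := polarM2 a b 1 c; rewrite !mulr1 => E3.
apply: (lin (esym (f_equal2 +%R (f_equal2 +%R E1 E2) (congr1 -%R E3)))).
by ring.
Qed.

Lemma qconjK : involutive (qconj n).
Proof.
move=> a; rewrite /qconj polarDl polarNl polarZl.
have n1 : n 1 = 1.
  apply/eqP; rewrite -subr_eq0; apply: contraT => n1.
  have [_ nd nM] := Hn; have E b : n b = n 1 * n b by rewrite -nM mul1r.
  have n0 b : n b = 0.
    apply/eqP; have /eqP := E b; rewrite -subr_eq0 -{1}[n b]mul1r -mulrBl.
    by rewrite mulf_eq0 -opprB oppr_eq0 (negPf n1).
  have := oner_neq0 H; rewrite [X in X != _](nd 1) ?eqxx // => b.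
  by rewrite /polar !n0; ring.
have -> : <<1, 1>> = 2%:R by have := nD 1 1; case: Hn => -[nZ _] _ _;
  rewrite -mulr2n -scaler_nat nZ n1 => E;
  apply: (lin (esym E)); ring.
have -> : <<a, 1>> * 2%:R - <<a, 1>> = <<a, 1>> by ring.
by rewrite opprB addrC subrK.
Qed.

End QconjTheory.

(* Main.v *)
Require Import Defs.
From mathcomp Require Import all_boot all_algebra all_field.

Import GRing.Theory.
Local Open Scope ring_scope.

(** Write a^* for the conjugate of a in H, t(a) = a + a^* for its trace and
    [a, b] = a b - b a for commutators.

    In Ac the identity a m = m a^* forces the right action of H to reverse
    products, (m a) b = m (b a), and likewise on the left; in Aa the actions
    respect products.  An element on which an action does both is killed by all
    commutators, and by the ideal that they generate; this ideal contains 1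
    because H is not commutative, so such an element is 0.  Hence, in any
    A = Aa + Ac, an element on which one of the two actions reverses products
    lies in Ac, and an element on which the left action respects products lies
    in Aa ([left_anti_in_Ac], [right_anti_in_Ac], [left_assoc_in_Aa]).

    The products involving Ac are settled by this criterion.  As a and a^* act
    on v in Ac with a v + v a = t(a) v, the linearized alternative laws give,
    for u in Aa and v, w in Ac,

      (u v) a = (u a^* ) v,    a (v u) = v (a^* u),    a (v w) = v (w a),

    and iterating these shows that H acts on u v and on v u by reversing
    products, and on v w by respecting them.

    For u, w in Aa put x = u w.  The alternative laws give
    (a u) w - u (w a^* ) = a x - x a^*, and the right-hand side lies in Aa
    because its contribution from the Ac-component of x vanishes.  So modulo Aa
    the product on Aa is balanced: (a u) w is congruent to u (w a^* ).  Moving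
    a b across in one step or in two gives u (w [a, b]) in Aa for all a, b, w.
    Since 1 is a sum of elements c [a, b], u w lies in Aa. *)

(** * Commutators in a composition algebra *)

Section CompositionAlgebra.

Variables (F : fieldType) (H : falgType F) (n : H -> F).
Hypothesis n_norm : composition_norm n.

Local Notation B := (polar n).
Local Notation bar := (qconj n).

Lemma polarC a b : B a b = B b a.
Proof. by rewrite /polar [a + b]addrC addrAC. Qed.

Lemma polarBl a b c : B (a - b) c = B a c - B b c.
Proof.
case: n_norm => -[_ [Bl _]] _ _.
have := Bl c (-1) b a; rewrite [a - b]addrC /= scaleN1r mulN1r => ->.
by rewrite addrC.
Qed.

Lemma polarDl a b c : B (a + b) c = B a c + B b c.
Proof.
case: n_norm => -[_ [Bl _]] _ _.
by have := Bl c 1 a b; rewrite /= scale1r mul1r.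
Qed.

Lemma polar_nondegenerate a : (forall b, B a b = 0) -> a = 0.
Proof. by case: n_norm => _ nondeg _; apply: nondeg. Qed.

Lemma qconjB a b : bar (a - b) = bar a - bar b.
Proof.
rewrite /qconj polarBl scalerBl !opprB addrACA [RHS]addrACA.
by congr (_ + _); apply: addrC.
Qed.

Lemma qconj_add a b : bar (a + b) = bar a + bar b.
Proof. by rewrite /qconj polarDl scalerDl opprD addrACA. Qed.

Lemma mul_qconj_polar a b : a * bar b + b * bar a = (B a b)%:A.
Proof.
have := qconjM n_norm (a + b).
rewrite qconj_add mulrDl (mulrDr a (bar a)) (mulrDr b (bar a)) !(qconjM n_norm)
  /polar !scalerBl => <-.
by rewrite [RHS]addrAC addrA addrK -(addrA (n a)%:A) [(n a)%:A + _]addrC addrK.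
Qed.

Lemma skew_trace0 a : bar a = - a -> B a 1 = 0.
Proof.
move=> bar_a; have := qconjD n a; rewrite bar_a subrr => /esym/eqP.
by rewrite scaler_eq0 oner_eq0 orbF => /eqP.
Qed.

Lemma commutator_qconj a b : bar a * b - b * bar a = b * a - a * b.
Proof.
rewrite /qconj mulrBl mulrBr -scalerAl -scalerAr mul1r mulr1 opprB.
by rewrite addrC addrA subrK.
Qed.

(** For a commutator x, the identity x c^* + c x^* = B(x, c) thus becomes
    x c^* - c x = B(x, c), with left-hand side in the ideal of x. *)
Lemma commutator_skew a b : bar (a * b - b * a) = - (a * b - b * a).
Proof.
by rewrite qconjB !(qconjMr n_norm) !commutator_qconj opprB.
Qed.

Lemma dim_le2 (p q : H) :
  (forall x, exists c d : F, x = c *: p + d *: q) -> (\dim {:H} <= 2)%N.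
Proof.
move=> gen.
have /dimvS/leq_trans -> // : ({:H} <= <[p]> + <[q]>)%VS.
  apply/subvP => x _; have [c [d ->]] := gen x.
  by apply: memv_add; apply/memvZ/memv_line.
by apply: leq_trans (dimv_add_leqif _ _) _; rewrite !dim_vline; do 2!case: eqP.
Qed.

(** If H is commutative and s(x) = x - x^*, then
    x s(y) = (x y + x^* y) - (x y^* + y x^* ) = t(x) y - B(x, y).
    When s(y)^2, a scalar by the case x = s(y), is nonzero, s(y) is invertible
    and this displays H as the span of y s(y) and s(y).  So all s(y) have square
    0; then s(x) s(y) = - B(s(x), y) has square 0 too, so that s = 0 by
    nondegeneracy, and t(x) y = B(x, y) puts every y in F.  This avoids any case
    distinction on the characteristic. *)
Lemma dim_gt2_noncommutative :
  (2 < \dim {:H})%N -> ~ (forall a b : H, a * b = b * a).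
Proof.
move=> dimH comm.
have gen (p q : H) : ~ (forall x, exists c d : F, x = c *: p + d *: q).
  by move=> pq; have := dim_le2 _ _ pq; rewrite leqNgt dimH.
pose s x := x - bar x.
have trs x : B (s x) 1 = 0.
  by apply: skew_trace0; rewrite qconjB (qconjK n_norm) opprB.
have mul_s x y : x * s y = B x 1 *: y - (B x y)%:A.
  rewrite -mul_qconj_polar -[B x 1 *: y]mulr_algl -qconjD mulrDl.
  by rewrite opprD addrACA (comm (bar x)) subrr addr0 -mulrBr.
have s_polar0 y : B (s y) y = 0.
  apply/eqP/negPn/negP => k0; pose k := - B (s y) y.
  have k_neq0 : k != 0 by rewrite oppr_eq0.
  apply: (gen (y * s y) (s y)) => x.
  exists (k^-1 * B x 1), (- (k^-1 * B x y)).
  rewrite scaleNr -!scalerA -scalerBr scalerAl -(mulr_algl (B x y)) -mulrBl.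
  rewrite -mul_s -mulrA (mul_s (s y)) trs scale0r sub0r -scaleNr mulr_algr.
  by rewrite scalerA mulVf ?scale1r.
have s0 x : s x = 0.
  apply: polar_nondegenerate => y; apply/eqP.
  have : s x * s y * (s x * s y) = 0.
    rewrite -mulrA (comm (s y)) !mulrA (mul_s (s x)) trs s_polar0.
    by rewrite !scale0r subr0 !mul0r.
  rewrite mul_s trs scale0r sub0r -scaleNr mulr_algl scalerA => /eqP.
  by rewrite scaler_eq0 oner_eq0 orbF mulf_eq0 orbb oppr_eq0.
have tr0 x : B x 1 = 0.
  apply/eqP/negPn/negP => t_neq0; apply: (gen 1 0) => y.
  have := mul_s x y; rewrite s0 mulr0 => /esym/eqP.
  rewrite subr_eq0 => /eqP y_eq.
  exists ((B x 1)^-1 * B x y), 0.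
  by rewrite scale0r addr0 -scalerA -y_eq scalerA mulVf ?scale1r.
have /eqP := oner_neq0 H; apply.
by apply: polar_nondegenerate => x; rewrite polarC tr0.
Qed.

(** A nonzero x = [a, b] has B(x, c) <> 0 for some c, and then the scalar
    B(x, c) = x c^* - c x lies in P. *)
Lemma commutator_ideal_full (P : {pred H}) :
    (2 < \dim {:H})%N -> submod_closed P ->
    (forall a b c, (a * b - b * a) * c \in P) ->
    (forall a b c, c * (a * b - b * a) \in P) ->
  1 \in P.
Proof.
move=> dimH [P0 Plin] Pr Pl; apply/negPn/negP => P1.
have PZ k x : x \in P -> k *: x \in P.
  by move=> Px; have := Plin k _ _ Px P0; rewrite addr0.
apply: (dim_gt2_noncommutative dimH) => a b; apply/eqP; rewrite -subr_eq0.
apply/eqP/polar_nondegenerate => c; apply/eqP/negPn/negP => k_neq0.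
case/negP: P1; set x := a * b - b * a in k_neq0 *.
have -> : 1 = (B x c)^-1 *: (-1 *: (c * x) + x * bar c).
  have := mul_qconj_polar x c.
  rewrite commutator_skew mulrN scaleN1r addrC => ->.
  by rewrite scalerA mulVf ?scale1r.
by apply/PZ/Plin; [apply: Pl | apply: Pr].
Qed.

(** One-sided multiples of commutators suffice, as
    c [a, b] = [c a, b] - [c, b] a. *)
Lemma commutator_right_ideal_full (P : {pred H}) :
    (2 < \dim {:H})%N -> submod_closed P ->
  (forall a b c, (a * b - b * a) * c \in P) -> 1 \in P.
Proof.
move=> dimH Psub Pr; apply: commutator_ideal_full => // a b c.
have -> : c * (a * b - b * a) =
    -1 *: ((c * b - b * c) * a) + (c * a * b - b * (c * a)) * 1.
  by rewrite mulr1 scaleN1r mulrBr mulrBl opprB !mulrA [RHS]addrC addrA subrK.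
by case: Psub => _; apply.
Qed.

(** Here [a, b] c = [a, b c] - b [a, c]. *)
Lemma commutator_left_ideal_full (P : {pred H}) :
    (2 < \dim {:H})%N -> submod_closed P ->
  (forall a b c, c * (a * b - b * a) \in P) -> 1 \in P.
Proof.
move=> dimH Psub Pl; apply: commutator_ideal_full => // a b c.
have -> : (a * b - b * a) * c =
    -1 *: (b * (a * c - c * a)) + 1 * (a * (b * c) - b * c * a).
  by rewrite mul1r scaleN1r mulrBr mulrBl opprB !mulrA [RHS]addrC addrA subrK.
by case: Psub => _; apply.
Qed.

End CompositionAlgebra.

(** * Products of the components *)

Section Submodules.

Variables (F : fieldType) (A : lmodType F) (M : {pred A}).
Hypothesis M_sub : submod_closed M.

Lemma submod0 : 0 \in M.
Proof. by case: M_sub. Qed.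

Lemma submodZ c x : x \in M -> c *: x \in M.
Proof. by case: M_sub => M0 Mlin Mx; rewrite -[c *: x]addr0 Mlin. Qed.

Lemma submodD x y : x \in M -> y \in M -> x + y \in M.
Proof. by case: M_sub => M0 Mlin Mx My; rewrite -[x]scale1r Mlin. Qed.

Lemma submodB x y : x \in M -> y \in M -> x - y \in M.
Proof. by move=> Mx My; rewrite -scaleN1r; apply/submodD/submodZ. Qed.

End Submodules.

Section Grading.

Variables (F : fieldType) (A : lmodType F) (mul : {bilinear A -> A -> A}).
Variables (e : A) (H : falgType F) (n : H -> F) (iota : {linear H -> A}).
Variables Aa Ac : {pred A}.
Hypotheses (A_alternative : alternative mul) (A_unital : unit_element mul e).
Hypotheses (n_norm : composition_norm n) (dimH : (2 < \dim {:H})%N).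
Hypothesis H_in_A : unital_embedding mul iota e.
Hypothesis Aa_associative : associative_bimodule mul iota Aa.
Hypothesis Ac_Cayley : Cayley_bimodule mul iota n Ac.
Hypothesis A_decomposition : direct_sum Aa Ac.

Local Notation "x ** y" := (mul x y) (at level 40, left associativity).
Local Notation bar := (qconj n).
Local Notation tr a := (polar n a 1).

Lemma left_alternative_linearized x y z :
  x ** (y ** z) + y ** (x ** z) = (x ** y + y ** x) ** z.
Proof.
case: A_alternative => alt _.
have := alt (x + y) z; rewrite !(linearDl, linearD) /= !alt.
rewrite -!addrA => /addrI; rewrite !addrA => /addIr.
by move=> ->.
Qed.

Lemma right_alternative_linearized x y z :
  (x ** y) ** z + (x ** z) ** y = x ** (y ** z + z ** y).
Proof.
case: A_alternative => _ alt.
have := alt x (y + z); rewrite !(linearDl, linearD) /= !linearDl /= !alt.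
rewrite -!addrA => /addrI; rewrite !addrA => /addIr.
by move=> E; rewrite addrC E addrC.
Qed.

Lemma iota1l x : iota 1 ** x = x.
Proof. by case: H_in_A => _ -> _; case: (A_unital x). Qed.

Lemma iota1r x : x ** iota 1 = x.
Proof. by case: H_in_A => _ -> _; case: (A_unital x). Qed.

Lemma iotaM a b : iota (a * b) = iota a ** iota b.
Proof. by case: H_in_A. Qed.

Lemma iota_qconj a : iota (bar a) = tr a *: iota 1 - iota a.
Proof. by rewrite -linearZ -linearB. Qed.

Lemma mul_iota_qconj x a : x ** iota (bar a) = tr a *: x - x ** iota a.
Proof. by rewrite iota_qconj linearB linearZ /= iota1r. Qed.

Lemma iota_qconj_mul x a : iota (bar a) ** x = tr a *: x - iota a ** x.
Proof. by rewrite iota_qconj linearBl linearZl_LR /= iota1l. Qed.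

Lemma Aa_sub : submod_closed Aa.
Proof. by case: Aa_associative => -[]. Qed.

Lemma Ac_sub : submod_closed Ac.
Proof. by case: Ac_Cayley => -[]. Qed.

Lemma Aa_mul a x : x \in Aa -> iota a ** x \in Aa.
Proof. by case: Aa_associative => -[_ Aa_bimod] _ /(Aa_bimod a) []. Qed.

Lemma mul_Aa a x : x \in Aa -> x ** iota a \in Aa.
Proof. by case: Aa_associative => -[_ Aa_bimod] _ /(Aa_bimod a) []. Qed.

Lemma mul_Ac a x : x \in Ac -> x ** iota a \in Ac.
Proof. by case: Ac_Cayley => -[_ Ac_bimod] _ /(Ac_bimod a) []. Qed.

Lemma Aa_assocl a b x : x \in Aa -> iota a ** (iota b ** x) = iota (a * b) ** x.
Proof.
case: Aa_associative => _ /(_ a b x) assoc /assoc [_ _ /eqP].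
by rewrite subr_eq0 iotaM => /eqP.
Qed.

Lemma Aa_assocr a b x : x \in Aa -> x ** iota a ** iota b = x ** iota (a * b).
Proof.
case: Aa_associative => _ /(_ a b x) assoc /assoc [/eqP + _ _].
by rewrite subr_eq0 iotaM => /eqP.
Qed.

Lemma Ac_qconj a x : x \in Ac -> iota a ** x = x ** iota (bar a).
Proof. by case: Ac_Cayley => _; apply. Qed.

Lemma Ac_trace a x : x \in Ac -> iota a ** x + x ** iota a = tr a *: x.
Proof. by move=> Acx; rewrite Ac_qconj // mul_iota_qconj subrK. Qed.

(** In b (x a) + x (b a) = (b x + x b) a the right-hand side is t(b) (x a), and
    x a lies in Ac, so that b (x a) = (x a) b^* = t(b) (x a) - (x a) b. *)
Lemma Ac_antir a b x : x \in Ac -> x ** iota a ** iota b = x ** iota (b * a).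
Proof.
move=> Acx; have := left_alternative_linearized (iota b) x (iota a).
rewrite Ac_trace // (Ac_qconj b _ (mul_Ac a _ Acx)) mul_iota_qconj linearZl_LR.
rewrite -iotaM -addrA -[X in _ = X]addr0 => /addrI/eqP.
by rewrite addrC subr_eq0 => /eqP.
Qed.

Lemma Ac_antil a b x : x \in Ac -> iota a ** (iota b ** x) = iota (b * a) ** x.
Proof.
move=> Acx; rewrite (Ac_qconj b) // Ac_qconj ?mul_Ac // Ac_antir //.
by rewrite Ac_qconj // (qconjMr n_norm).
Qed.

(** The two hypotheses together make every c [a, b] kill x. *)
Lemma left_action_eq0 x :
    (forall a b, iota a ** (iota b ** x) = iota (a * b) ** x) ->
    (forall a b, iota a ** (iota b ** x) = iota (b * a) ** x) ->
  x = 0.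
Proof.
move=> assoc anti; rewrite -(iota1l x); apply/eqP.
pose P := [pred h | iota h ** x == 0].
apply: (@commutator_left_ideal_full _ _ _ n_norm P dimH) => [|a b c].
  split=> [|c a b]; rewrite !inE ?linear0 ?linear0l //.
  by move=> /eqP ax0 /eqP bx0; rewrite linearP linearPl /= ax0 bx0 scaler0 addr0.
rewrite inE -assoc linearB linearBl /= -!assoc.
by rewrite [X in _ - X]anti assoc subrr linear0.
Qed.

Lemma right_action_eq0 x :
    (forall a b, x ** iota a ** iota b = x ** iota (a * b)) ->
    (forall a b, x ** iota a ** iota b = x ** iota (b * a)) ->
  x = 0.
Proof.
move=> assoc anti; rewrite -(iota1r x); apply/eqP.
pose P := [pred h | x ** iota h == 0].
apply: (@commutator_right_ideal_full _ _ _ n_norm P dimH) => [|a b c].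
  split=> [|c a b]; rewrite !inE ?linear0 //.
  by move=> /eqP ax0 /eqP bx0; rewrite !linearP /= ax0 bx0 scaler0 addr0.
by rewrite inE -assoc !linearB /= -!assoc [X in _ - X]anti assoc subrr linear0l.
Qed.

Lemma left_anti_in_Ac x :
  (forall a b, iota a ** (iota b ** x) = iota (b * a) ** x) -> x \in Ac.
Proof.
move=> anti; case: A_decomposition => /(_ x) [u [v [Aau Acv xE]]] _.
suff u0 : u = 0 by rewrite xE u0 add0r.
apply: left_action_eq0 => a b; first exact: Aa_assocl.
have -> : u = x - v by rewrite xE addrK.
by rewrite !linearB /= anti Ac_antil.
Qed.

Lemma right_anti_in_Ac x :
  (forall a b, x ** iota a ** iota b = x ** iota (b * a)) -> x \in Ac.
Proof.
move=> anti; case: A_decomposition => /(_ x) [u [v [Aau Acv xE]]] _.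
suff u0 : u = 0 by rewrite xE u0 add0r.
apply: right_action_eq0 => a b; first exact: Aa_assocr.
have -> : u = x - v by rewrite xE addrK.
by rewrite !linearBl /= anti Ac_antir.
Qed.

Lemma left_assoc_in_Aa x :
  (forall a b, iota a ** (iota b ** x) = iota (a * b) ** x) -> x \in Aa.
Proof.
move=> assoc; case: A_decomposition => /(_ x) [u [v [Aau Acv xE]]] _.
suff v0 : v = 0 by rewrite xE v0 addr0.
apply: left_action_eq0 => a b; last exact: Ac_antil.
have -> : v = x - u by rewrite xE addrC addKr.
by rewrite !linearB /= assoc Aa_assocl.
Qed.

Lemma Ac_Ac_even v w : v \in Ac -> w \in Ac -> v ** w \in Aa.
Proof.
move=> Acv Acw.
have shift a w' : w' \in Ac -> iota a ** (v ** w') = v ** (w' ** iota a).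
  move=> Acw'; apply: (addIr (v ** (iota a ** w'))).
  rewrite left_alternative_linearized Ac_trace // -linearD /= addrC Ac_trace //.
  by rewrite linearZ linearZl_LR.
apply: left_assoc_in_Aa => a b.
by rewrite shift // shift ?mul_Ac // shift // Ac_antir.
Qed.

Lemma Aa_Ac_odd u v : u \in Aa -> v \in Ac -> u ** v \in Ac.
Proof.
move=> Aau Acv.
have shift a u' : u' ** v ** iota a = u' ** iota (bar a) ** v.
  apply: (addIr (u' ** iota a ** v)); rewrite right_alternative_linearized addrC.
  rewrite mul_iota_qconj linearBl linearZl_LR /= addrC subrK addrC Ac_trace //.
  by rewrite linearZ.
apply: right_anti_in_Ac => a b.
by rewrite !shift Aa_assocr // (qconjMr n_norm).
Qed.

Lemma Ac_Aa_odd u v : u \in Aa -> v \in Ac -> v ** u \in Ac.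
Proof.
move=> Aau Acv.
have shift a u' : iota a ** (v ** u') = v ** (iota (bar a) ** u').
  apply: (addIr (v ** (iota a ** u'))); rewrite left_alternative_linearized.
  by rewrite iota_qconj_mul linearB /= subrK Ac_trace // linearZ linearZl_LR.
apply: left_anti_in_Ac => a b.
by rewrite !shift Aa_assocl // (qconjMr n_norm).
Qed.

(** The difference is a x - x a^* with x = u w.  The Ac-component q of x
    contributes a q - q a^* = 0. *)
Lemma Aa_balanced u w a : u \in Aa -> w \in Aa ->
  iota a ** u ** w - u ** (w ** iota (bar a)) \in Aa.
Proof.
move=> Aau Aaw; pose x := u ** w.
have -> : iota a ** u ** w - u ** (w ** iota (bar a)) =
    iota a ** x - x ** iota (bar a).
  (* The associator d = (u, a, w) is both -(a, u, w) and (u, w, a^* ). *)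
  pose d := u ** iota a ** w - u ** (iota a ** w).
  have -> : iota a ** x = iota a ** u ** w + d.
    apply: (addIr (u ** (iota a ** w))).
    by rewrite left_alternative_linearized linearDl /= -addrA subrK.
  have -> : x ** iota (bar a) = u ** (w ** iota (bar a)) + d.
    apply: (addIr (u ** iota (bar a) ** w)).
    rewrite right_alternative_linearized linearD /= -addrA; congr (_ + _).
    rewrite iota_qconj_mul mul_iota_qconj linearB linearBl linearZ linearZl_LR /=.
    by rewrite [RHS]addrC addrA subrK.
  by rewrite opprD addrACA subrr addr0.
case: A_decomposition => /(_ x) [p [q [Aap Acq ->]]] _.
rewrite linearD linearDl /= (Ac_qconj a _ Acq) opprD addrACA subrr addr0.
by apply: (submodB _ _ _ Aa_sub); [apply: Aa_mul | apply: mul_Aa].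
Qed.

(** Modulo Aa, balancing gives u (w' (b^* a^* )) when it is applied to a b, and
    u (w' (a^* b^* )) when it is applied to a and then b, from the same
    ((a b) u) w'. *)
Lemma Aa_Aa_even u w : u \in Aa -> w \in Aa -> u ** w \in Aa.
Proof.
move=> Aau Aaw; rewrite -[w]iota1r.
pose P := [pred h | u ** (w ** iota h) \in Aa].
apply: (@commutator_left_ideal_full _ _ _ n_norm P dimH) => [|a b c].
  split=> [|c a b]; rewrite !inE ?linear0 ?linear0 ?(submod0 _ _ _ Aa_sub) //.
  by move=> Pa Pb; rewrite !linearP; case: Aa_sub => _; apply.
rewrite inE -Aa_assocr // !linearB /=.
have := mul_Aa c _ Aaw; set w' := w ** _ => Aaw'.
rewrite -(qconjK n_norm a) -(qconjK n_norm b).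
(* Balancing turns a into a^*, hence the commutator of two conjugates. *)
move: (bar a) (bar b) => {}a {}b.
have ab_bal := Aa_balanced u w' (a * b) Aau Aaw'.
have a_bal := Aa_balanced (iota b ** u) w' a (Aa_mul b _ Aau) Aaw'.
have b_bal := Aa_balanced u _ b Aau (mul_Aa (bar a) _ Aaw').
have := submodB _ _ _ Aa_sub _ _ ab_bal (submodD _ _ _ Aa_sub _ _ a_bal b_bal).
rewrite Aa_assocl // Aa_assocr // (qconjMr n_norm) addrA subrK.
by rewrite opprB [_ - _ + _]addrC addrA subrK.
Qed.

Lemma Z2_graded : Z2_grading mul (fun i : 'Z_2 => if i == 0 then Aa else Ac).
Proof.
split=> [i| |i j x y]; first by case: ifP => _; [apply: Aa_sub | apply: Ac_sub].
  exact: A_decomposition.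
case: i => [[|[|//]] ?]; case: j => [[|[|//]] ?]; rewrite -!val_eqE /=.
- exact: Aa_Aa_even.
- exact: Aa_Ac_odd.
- by move=> Acx Aay; apply: Ac_Aa_odd.
- exact: Ac_Ac_even.
Qed.

End Grading.

Theorem corollary3p6 (F : fieldType) (A : lmodType F)
    (mul : {bilinear A -> A -> A}) (e : A)
    (A_alternative : alternative mul) (A_unital : unit_element mul e)
    (H : falgType F) (n : H -> F) (H_quaternion : generalized_quaternion n)
    (iota : {linear H -> A}) (H_in_A : unital_embedding mul iota e)
    (Aa Ac : {pred A})
    (Aa_associative : associative_bimodule mul iota Aa)
    (Ac_Cayley : Cayley_bimodule mul iota n Ac)
    (A_decomposition : direct_sum Aa Ac) :
  Z2_grading mul (fun i : 'Z_2 => if i == 0 then Aa else Ac).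
Proof.
case: H_quaternion => dim4 n_norm.
have dimH : (2 < \dim {:H})%N by rewrite dim4.
exact: (Z2_graded _ _ _ e _ n iota).
Qed.
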